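(* Let $I$ be a $k$-subset of $\{1,\dots,n\}$ which is a disjoint union $I=I_1\cup I_2$ with $$I_1=\{\sigma^p(i),\dots,\sigma(i),i\},\qquad I_2=\{\sigma^q(j),\dots,\sigma(j),j\},$$ where $p\ge 0$, $q\ge 0$ and $p+q+2=k$. Let $J$ be the $k$-subset $$J=\{\sigma^{p+q+1}(i),\dots,\sigma^{p+1}(i)\}\cup\{\sigma^{p+q+1}(j),\dots,\sigma^{q+1}(j)\}.$$ Then $$\overleftarrow{[I]}=[J]\prod_{r=1}^p[\sigma^r(\mathbf{i})]\prod_{r=1}^q[\sigma^r(\mathbf{j})].$$
   Context: Let $k\le n$ be positive integers. $M_{k,n}$ is the set of complex $k\times n$ matrices $p$ with columns $p_1,\dots,p_n$. For a $k$-subset $I=\{i_1<\dots<i_k\}$ of $\{1,\dots,n\}$, $[I]$ (Plücker coordinate) is the function sending a matrix to its $k\times k$ minor with columns $i_1<\dots<i_k$. The homogeneous coordinate ring $\mathbb{C}[\mathrm{Gr}_{k,n}]$ of the Grassmannian is the subalgebra of $\mathbb{C}[M_{k,n}]$ generated by all $[I]$. The map $\sigma:\{1,\dots,n\}\to\{1,\dots,n\}$ is $i\mapsto i-1$ reduced modulo $n$, and it acts elementwise on $k$-subsets. For $i\in\{1,\dots,n\}$, $\mathbf{i}$ denotes the cyclic interval $\{\sigma^{k-1}(i),\dots,\sigma(i),i\}$. For $v_1,\dots,v_{k-1}\in\mathbb{C}^k$, $v_1\times\cdots\times v_{k-1}$ is the unique vector with $(v_1\times\cdots\times v_{k-1})^Tv=\det(v_1,\dots,v_{k-1},v)$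 for all $v\in\mathbb{C}^k$. The twist $\overleftarrow{p}\in M_{k,n}$ of $p\in M_{k,n}$ has $i$th column $\varepsilon_i\, p_{\sigma^{k-1}(i)}\times p_{\sigma^{k-2}(i)}\times\cdots\times p_{\sigma(i)}$, where $\varepsilon_i=(-1)^{i(k-i)}$ if $i\le k-1$ and $\varepsilon_i=1$ if $i\ge k$. For $f\in\mathbb{C}[\mathrm{Gr}_{k,n}]$ its twist is $\overleftarrow{f}(p)=f(\overleftarrow{p})$, again an element of $\mathbb{C}[\mathrm{Gr}_{k,n}]$. *)

(* Defs.v *)
From mathcomp Require Import all_boot all_order all_algebra.
From mathcomp Require Export reals complex.

Set Implicit Arguments.
Unset Strict Implicit.
Unset Printing Implicit Defensive.

Import GRing.Theory.
Local Open Scope ring_scope.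

(* The index set {1, ..., n} is modelled by 'I_n: the mathematical index i is
   the ordinal of value i - 1.  This shift preserves the order of the indices
   and turns [i |-> i - 1 mod n] into [ord_pred]. *)

Definition sigma {n : nat} (i : 'I_n) : 'I_n := ord_pred i.

Definition sigma_set {n : nat} (A : {set 'I_n}) : {set 'I_n} := sigma @: A.

(* {sigma^b(i), ..., sigma^(a+1)(i), sigma^a(i)} *)
Definition sigma_seg {n : nat} (a b : nat) (i : 'I_n) : {set 'I_n} :=
  [set iter (r : nat) sigma i | r : 'I_b.+1 & (a <= r)%N].

(* The cyclic interval written as a bold i. *)
Definition cyc_int (k : nat) {n : nat} (i : 'I_n) : {set 'I_n} :=
  sigma_seg 0 k.-1 i.

Section Twist.
Variable F : comNzRingType.

(* [enum_val] lists the elements of A in increasing order (see [pluckerE]).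
   If A does not have k elements then [conform_mx] returns its default 0. *)
Definition plucker {k n : nat} (A : {set 'I_n}) (M : 'M[F]_(k, n)) : F :=
  \det (conform_mx (0 : 'M[F]_k) (colsub (@enum_val _ (mem A)) M)).

(* The k x k matrix with columns v_1, ..., v_(k-1), w, where the v_c are the
   columns of V. *)
Definition add_last_col {k : nat} (V : 'M[F]_(k, k.-1)) (w : 'cV[F]_k) :
    'M[F]_k :=
  \matrix_(a, b) (if insub (b : nat) is Some c then V a c else w a 0).

(* v_1 x ... x v_(k-1) for the columns v_c of V.  Its a-th coordinate is forced
   by the defining property to be det(v_1, ..., v_(k-1), e_a); see [crossP] and
   [cross_uniq]. *)
Definition cross {k : nat} (V : 'M[F]_(k, k.-1)) : 'cV[F]_k :=
  \col_a \det (add_last_col V (delta_mx a 0)).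

(* Here the argument i is the 1-based index. *)
Definition twist_sign (k i : nat) : F :=
  if (i <= k.-1)%N then (-1) ^+ (i * (k - i)) else 1.

(* The c-th column (c = 0, ..., k-2) of the matrix below is the column
   of M of index sigma^(k-1-c)(i). *)
Definition twist {k n : nat} (M : 'M[F]_(k, n)) : 'M[F]_(k, n) :=
  \matrix_(a, i) (twist_sign k i.+1 *
    cross (colsub (fun c : 'I_k.-1 => iter (k.-1 - c) sigma i) M) a 0).

Definition twist_fun {k n : nat} (f : 'M[F]_(k, n) -> F) : 'M[F]_(k, n) -> F :=
  fun M => f (twist M).

Lemma add_last_col_det k (V : 'M[F]_(k.+1, k)) (w : 'cV[F]_k.+1) :
  \det (add_last_col (k := k.+1) V w) =
  \sum_a w a 0 * cofactor (add_last_col (k := k.+1) V 0) a ord_max.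
Proof.
rewrite (expand_det_col _ ord_max); apply: eq_bigr => a _; congr (_ * _).
  by rewrite mxE insubF //= ltnn.
congr (_ * \det _); apply/matrixP => x y; rewrite !mxE.
by case: insubP => // /negP[]; rewrite lift_max ltn_ord.
Qed.

Lemma crossP k (V : 'M[F]_(k, k.-1)) (w : 'cV[F]_k) : (0 < k)%N ->
  (cross V)^T *m w = (\det (add_last_col V w))%:M.
Proof.
case: k V w => // k V w _; apply/matrixP => x y; rewrite !ord1 !mxE mulr1n.
rewrite add_last_col_det; apply: eq_bigr => a _; rewrite !mxE mulrC.
congr (_ * _); rewrite add_last_col_det (bigD1 a) //= big1 ?addr0.
  by rewrite mxE !eqxx mul1r.
by move=> b ne_ba; rewrite mxE (negPf ne_ba) mul0r.
Qed.

Lemma cross_uniq k (V : 'M[F]_(k, k.-1)) (u : 'cV[F]_k) :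
  (forall w, u^T *m w = (\det (add_last_col V w))%:M) -> u = cross V.
Proof.
move=> uP; apply/matrixP => a j; rewrite !ord1 mxE.
have /matrixP/(_ 0 0) := uP (delta_mx a 0); rewrite !mxE mulr1n => <-.
rewrite (bigD1 a) //= big1 ?addr0 => [|b ne_ba]; rewrite !mxE ?eqxx ?mulr1 //.
by rewrite (negPf ne_ba) mulr0.
Qed.

Lemma pluckerE k n (f : 'I_k -> 'I_n) (M : 'M[F]_(k, n)) :
  {homo f : a b / (a < b)%N} -> plucker (f @: setT) M = \det (colsub f M).
Proof.
move=> f_incr.
have f_inj : injective f.
  move=> a b eq_f; apply/val_inj.
  by case: (ltngtP a b) => // /f_incr; rewrite eq_f ltnn.
have enumE : enum (f @: [set: 'I_k]) = [seq f a | a <- enum 'I_k].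
  apply: (inj_map val_inj).
  apply: (irr_sorted_eq ltn_trans ltnn).
  - apply: (subseq_sorted ltn_trans (s2 := map val (enum 'I_n))).
      by apply/map_subseq; rewrite enumT; apply: filter_subseq.
    by rewrite val_enum_ord iota_ltn_sorted.
  - rewrite -map_comp sorted_map.
    have : sorted ltn (map val (enum 'I_k)) by rewrite val_enum_ord iota_ltn_sorted.
    by rewrite sorted_map; apply: sub_sorted => a b; apply: f_incr.
  move=> x; congr (_ : bool); apply: eq_mem_map => y.
  rewrite mem_enum; apply/imsetP/mapP => [[a _ ->]|[a _ ->]]; exists a => //.
  by rewrite mem_enum.
have cardE : #|f @: [set: 'I_k]| = k by rewrite card_imset // cardsT card_ord.
rewrite /plucker; congr (\det _).
have -> : colsub f M = castmx (erefl, cardE)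
    (colsub (@enum_val _ (mem (f @: [set: 'I_k]))) M).
  apply/matrixP => a b; rewrite castmxE !mxE /= cast_ord_id; congr (M _ _).
  rewrite (enum_val_nth (f b)) /= enumE (nth_map b) ?size_enum_ord //.
  by rewrite nth_ord_enum.
set N := colsub _ _; move: (f @: _) cardE N => A eA; case: _ / eA => N.
by rewrite conform_mx_id castmx_id.
Qed.

End Twist.

(* Main.v *)
Require Import Defs.
From mathcomp Require Import all_boot all_order all_algebra.
From mathcomp Require Import zify ring.
Import GRing.Theory.
Local Open Scope ring_scope.

(** The columns of M are unrolled into a sequence v_0, v_1, ... with
    v_(x+n) = (-1)^(k-1) v_x.  With this sign, the determinant of k columns is
    unchanged when the first one is moved to the end and replaced by its
    translate by n.  So a Pluecker coordinate can be computed from any increasing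
    representatives of its index set that lie within one period, even if they
    straddle a multiple of n ([plucker_unroll]).  The same convention absorbs the
    signs in the definition of the twist: the unrolled columns of the twist are
    the cross products t_x = v_x x ... x v_(x+k-2) of consecutive columns,
    without any sign ([unroll_twist]).  Disjointness of the two arcs of I lets
    them be unrolled as two runs, one after the other and within one period
    ([unroll_disjoint_segs]); then J unrolls in the same way.

    What remains is an identity valid for every sequence v, with no periodicity
    and no relation between the starting points x1 and x2 of the two runs
    ([window_cross_det]): the determinant of t_x1, ..., t_(x1+p), t_x2, ...,
    t_(x2+q) factors.  Since t_x pairs with a vector w to det(v_x, ..., w), it
    annihilates v_x, ..., v_(x+k-2) and its pairing with v_(x+k-1) is the window
    determinant W_x = det(v_x, ..., v_(x+k-1)).
    Pairing the matrix T of all these cross products with the window at x1 + p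
    gives a block antitriangular matrix: one block is triangular with diagonal
    W_x1, ..., W_(x1+p), and the other is the matrix Y of pairings of the
    second run of t with the first q+1 vectors of the window
    ([det_cross_windows]).  A second pairing, with the window at x2 + q and its
    dual basis, relates det Y to the minor indexed by J ([det_dual_windows]).
    Eliminating det Y requires W_(x1+p) and W_(x2+q) to be nonzero; this is
    arranged by perturbing v over the polynomial ring and then setting the
    parameter to 0. *)

Set Implicit Arguments.
Unset Strict Implicit.
Unset Printing Implicit Defensive.

(** * Matrices given by sequences of columns *)

Definition colmx {F : comNzRingType} {k} (f : nat -> 'cV[F]_k) : 'M[F]_k :=
  \matrix_(x, y) f y x 0.

Definition window_det {F : comNzRingType} {k} (v : nat -> 'cV[F]_k) (x : nat) :
    F :=
  \det (colmx (fun y => v (x + y)%N)).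

(** For the unrolled columns of M this is the column of index x + k - 1 of the
    unrolled twist: the starting index is easier to follow than the final one. *)
Definition window_cross {F : comNzRingType} {k} (v : nat -> 'cV[F]_k) (x : nat) :
    'cV[F]_k :=
  cross (\matrix_(a < k, c < k.-1) v (x + c)%N a 0).

(** The enumeration x1, ..., x1 + a - 1, x2, x2 + 1, ... *)
Definition two_runs (a x1 x2 y : nat) : nat :=
  if (y < a)%N then (x1 + y)%N else (x2 + (y - a))%N.

Definition dot {F : comNzRingType} {k} (u w : 'cV[F]_k) : F :=
  \sum_a u a 0 * w a 0.

Section Columns.
Variables (F : comNzRingType) (k : nat).
Implicit Types f g v : nat -> 'cV[F]_k.

Lemma eq_colmx f g : (forall y, (y < k)%N -> f y = g y) -> colmx f = colmx g.
Proof. by move=> fg; apply/matrixP => x y; rewrite !mxE fg. Qed.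

Lemma det_colmxZ (c : nat -> F) f :
  \det (colmx (fun y => c y *: f y)) = (\prod_(y < k) c y) * \det (colmx f).
Proof.
have -> : colmx (fun y => c y *: f y) = colmx f *m diag_mx (\row_(y < k) c y).
  by apply/matrixP => x y; rewrite mul_mx_diag !mxE mulrC.
rewrite det_mulmx det_diag mulrC; congr (_ * _).
by apply: eq_bigr => y _; rewrite mxE.
Qed.

Lemma trmx_mul_colmx f g :
  (colmx f)^T *m colmx g = \matrix_(x < k, y < k) dot (f x) (g y).
Proof.
by apply/matrixP => x y; rewrite !mxE; apply: eq_bigr => z _; rewrite !mxE.
Qed.

End Columns.

(** Moving the window by one step permutes its columns cyclically, and the sign
    (-1)^(k-1) of that cycle is compensated by the one in the antiperiod.  In the
    proof the two windows are expanded along the column they do not share. *)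
Lemma det_antiperiodic (F : comNzRingType) (k : nat) (f : nat -> 'cV[F]_k)
    (m : nat) :
  (forall y, f (y + k)%N = (-1) ^+ k.-1 *: f y) ->
  window_det f m = \det (colmx f).
Proof.
case: k f => [|k] f fP.
  by rewrite /window_det !det_mx00.
elim: m => [|m <-]; first by congr (\det _); apply: eq_colmx.
rewrite /window_det (expand_det_col _ ord_max) [RHS](expand_det_col _ 0).
apply: eq_bigr => x _; rewrite !mxE /cofactor.
have -> : (m.+1 + (@ord_max k : nat) = (m + 0) + k.+1)%N by rewrite /=; lia.
rewrite fP !mxE /= addn0 exprD.
have -> : row' x (col' ord_max (colmx (fun y => f (m.+1 + y)%N)))
        = row' x (col' 0 (colmx (fun y => f (m + y)%N))).
  apply/matrixP => y z; rewrite !mxE lift_max; congr (f _ _ _).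
  by rewrite /= /bump /=; lia.
have := sqrr_sign F k; rewrite expr2 !addn0.
set e := (-1) ^+ k; set c := (-1) ^+ x; set d := \det _ => sq.
transitivity ((e * e) * (f m x 0 * (c * d))); first by ring.
by rewrite sq mul1r.
Qed.

(** The matrix is given by a function on nat, so that its size can be split as
    a + b here and as b + a elsewhere without casts. *)
Lemma det_lzero_block (F : comNzRingType) (a b k : nat) (g : nat -> nat -> F) :
  k = (a + b)%N ->
  (forall x y, (x < a)%N -> (y < b)%N -> g x (a + y)%N = 0) ->
  \det (\matrix_(x < k, y < k) g x y) =
  \det (\matrix_(x < a, y < a) g x y) *
  \det (\matrix_(x < b, y < b) g (a + x)%N (a + y)%N).
Proof.
move=> -> g0; rewrite -(submxK (\matrix_(_ < a + b, _ < a + b) _)).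
set A := ursubmx _; have -> : A = 0.
  by apply/matrixP => x y; rewrite !mxE /= g0.
rewrite det_lblock; congr (_ * _); congr (\det _);
  by apply/matrixP => x y; rewrite !mxE.
Qed.

(** Extending the k columns of f antiperiodically, the swapped matrix is, up to
    the sign (-1)^(k-1) on each of its last b columns, the window starting at b;
    and (k-1)b has the parity of ab. *)
Lemma det_swap_blocks (F : comNzRingType) (a b k : nat) (f : nat -> 'cV[F]_k) :
  k = (a + b)%N ->
  \det (colmx f) = (-1) ^+ (a * b) * \det (colmx (fun y => f (two_runs a b 0 y))).
Proof.
move=> kE.
have [k0|k_gt0] := posnP k.
  have -> : (a * b = 0)%N by lia.
  rewrite mul1r; case: {kE} k k0 f => // _ f; by rewrite !det_mx00.
pose h y := (-1) ^+ (k.-1 * (y %/ k)) *: f (y %% k)%N.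
have hP y : h (y + k)%N = (-1) ^+ k.-1 *: h y.
  by rewrite /h divnDr // divnn k_gt0 modnDr mulnDr muln1 addnC exprD scalerA.
have -> : colmx f = colmx h.
  apply: eq_colmx => y yk.
  by rewrite /h divn_small // modn_small // muln0 scale1r.
rewrite -(det_antiperiodic b hP) /window_det.
have -> : colmx (fun y => h (b + y)%N) =
  colmx (fun y =>
    (if (y < a)%N then 1 else (-1) ^+ k.-1) *: f (two_runs a b 0 y)).
  apply: eq_colmx => y yk; rewrite /h /two_runs; case: ltnP => ya.
    by rewrite divn_small ?modn_small ?muln0 //; lia.
  have -> : (b + y = (y - a) + k)%N by lia.
  rewrite divnDr // divnn k_gt0 modnDr divn_small ?modn_small ?muln1 //; lia.
rewrite det_colmxZ; congr (_ * _).
rewrite kE big_split_ord /= big1 ?mul1r => [|x _]; last by rewrite ltn_ord.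
under eq_bigr => x _ do rewrite ltnNge leq_addr /=.
rewrite prodr_const card_ord -exprM -[LHS]signr_odd -[RHS]signr_odd.
congr (_ ^+ nat_of_bool _); rewrite !oddM.
case: b {kE h hP} => [|b]; rewrite ?andbF // addnS /= oddD.
by case: (odd a); case: (odd b).
Qed.

Lemma det_zero_block (F : comNzRingType) (a b k : nat) (g : nat -> nat -> F) :
  k = (a + b)%N ->
  (forall x y, (x < a)%N -> (y < b)%N -> g x y = 0) ->
  \det (\matrix_(x < k, y < k) g x y) = (-1) ^+ (a * b) *
  (\det (\matrix_(x < a, y < a) g x (b + y)%N) *
   \det (\matrix_(x < b, y < b) g (a + x)%N y)).
Proof.
move=> kE g0; pose f y : 'cV[F]_k := \col_x g x y.
have -> : \matrix_(x < k, y < k) g x y = colmx f.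
  by apply/matrixP => x y; rewrite !mxE.
rewrite (det_swap_blocks _ kE); congr (_ * _).
pose h x y := g x (two_runs a b 0 y).
have -> : colmx (fun y => f (two_runs a b 0 y)) = \matrix_(x < k, y < k) h x y.
  by apply/matrixP => x y; rewrite !mxE.
rewrite (det_lzero_block kE) => [|x y xa yb]; last first.
  by rewrite /h /two_runs ltnNge leq_addr /= add0n addKn g0.
by congr (_ * _); congr (\det _); apply/matrixP => x y;
  rewrite !mxE /h /two_runs ?ltn_ord // ltnNge leq_addr /= add0n addKn.
Qed.

(** * Cross products of consecutive columns *)

Section WindowCross.
Variables (F : comNzRingType) (k : nat) (v : nat -> 'cV[F]_k).

Lemma dot_window_cross x w : (0 < k)%N ->
  dot (window_cross v x) w =
  \det (colmx (fun y => if (y < k.-1)%N then v (x + y)%N else w)).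
Proof.
move=> k_gt0; set V := (\matrix_(a < k, c < k.-1) v (x + c)%N a 0).
have -> : dot (window_cross v x) w = ((cross V)^T *m w) 0 0.
  by rewrite [RHS]mxE; apply: eq_bigr => a _; rewrite [_^T _ _]mxE.
rewrite crossP // mxE mulr1n; congr (\det _); apply/matrixP => a b; rewrite !mxE.
case: insubP => [c cP <-|/negPf ->] //=; by rewrite mxE ltn_ord.
Qed.

Lemma dot_window_cross0 x y : (y < k.-1)%N ->
  dot (window_cross v x) (v (x + y)%N) = 0.
Proof.
move=> yk; have k_gt0 : (0 < k)%N by lia.
have yk' : (y < k)%N by lia.
have k1 : (k.-1 < k)%N by lia.
rewrite dot_window_cross // -det_tr.
apply: (@determinant_alternate _ _ _ (Ordinal yk') (Ordinal k1)).
  by rewrite -val_eqE /= neq_ltn yk.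
by move=> a; rewrite !mxE /= yk ltnn.
Qed.

Lemma dot_window_cross_next x : (0 < k)%N ->
  dot (window_cross v x) (v (x + k.-1)%N) = window_det v x.
Proof.
move=> k_gt0; rewrite dot_window_cross //; congr (\det _).
apply: eq_colmx => y yk; case: ltnP => // ky; congr (v (_ + _)%N); lia.
Qed.

(** The matrix is triangular: a cross product annihilates the columns of its own
    window, hence those that close the windows starting earlier. *)
Lemma det_dot_window_cross x m : (0 < k)%N -> (m <= k)%N ->
  \det (\matrix_(y < m, z < m)
          dot (window_cross v (x + y)%N) (v (x + k.-1 + z)%N)) =
  \prod_(y < m) window_det v (x + y)%N.
Proof.
move=> k_gt0 mk; rewrite -det_tr det_trig.
  apply: eq_bigr => y _; rewrite !mxE.
  by rewrite -dot_window_cross_next //; congr (dot _ (v _)); lia.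
apply/is_trig_mxP => z y zy; rewrite !mxE.
have zm := ltn_ord z; have ym := ltn_ord y.
have -> : (x + k.-1 + z = (x + y) + (k.-1 + z - y))%N by lia.
apply: dot_window_cross0; lia.
Qed.

End WindowCross.

(** * The determinant of two runs of cross products *)

Section Generic.
Variables (F : idomainType) (k p q x1 x2 : nat) (v : nat -> 'cV[F]_k).
Hypothesis kE : k = (p + q).+2.
Hypothesis Di_neq0 : window_det v (x1 + p)%N != 0.
Hypothesis Dj_neq0 : window_det v (x2 + q)%N != 0.

Let a := p.+1.
Let b := q.+1.
Let s : F := (-1) ^+ (a * b).
Let T := colmx (fun y => window_cross v (two_runs a x1 x2 y)).
Let VJ := colmx (fun y => v (two_runs b (x1 + p) (x2 + q) y)).
Let Y := \matrix_(x < b, y < b)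
  dot (window_cross v (x2 + x)%N) (v (x1 + p + y)%N).

(** The matrix of pairings of T with the window at x1 + p has a zero block: the
    window begins with q+1 vectors shared by the windows of all the cross
    products of the first run. *)
Lemma det_cross_windows :
  \det T * window_det v (x1 + p)%N =
  s * ((\prod_(x < a) window_det v (x1 + x)%N) * \det Y).
Proof.
rewrite /window_det -det_tr -det_mulmx trmx_mul_colmx.
pose g x y := dot (window_cross v (two_runs a x1 x2 x)) (v (x1 + p + y)%N).
rewrite -[\matrix_(_, _) _]/(\matrix_(x < k, y < k) g x y).
rewrite (@det_zero_block _ a b) => [||x y xa yb]; first last.
- rewrite /g /two_runs xa.
  have -> : (x1 + p + y = (x1 + x) + (p + y - x))%N by lia.
  by apply: dot_window_cross0; lia.
- by lia.
congr (_ * (_ * _)).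
  rewrite -det_dot_window_cross; try lia.
  congr (\det _); apply/matrixP => x y; rewrite !mxE /g /two_runs ltn_ord.
  by congr (dot _ (v _)); lia.
congr (\det _); apply/matrixP => x y; rewrite !mxE /g /two_runs.
by rewrite ltnNge leq_addr addKn.
Qed.

(** Let f consist of the second run of cross products followed by the first p+1
    vectors of the basis dual to the window K at x2 + q.  Pairing f with K, and
    then with the columns of VJ, gives two matrices with a zero block; comparing
    their determinants eliminates det f. *)
Lemma det_dual_windows :
  s * ((\prod_(x < b) window_det v (x2 + x)%N) * \det VJ)
  = \det Y * window_det v (x2 + q)%N.
Proof.
set D := window_det v (x2 + q)%N.
set K := colmx (fun y => v (x2 + q + y)%N).
(* The rows of the adjugate are D times the dual basis of K; they are used to
   avoid division. *)
pose U x : 'cV[F]_k := if insub x is Some o then (row o (\adj K))^T else 0.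
have UP x y : (x < k)%N -> (y < k)%N ->
    dot (U x) (v (x2 + q + y)%N) = D *+ (x == y).
  move=> xk yk; have /matrixP/(_ (Ordinal xk) (Ordinal yk)) := mul_adj_mx K.
  rewrite !mxE => <-; apply: eq_bigr => z _.
  by rewrite /U insubT !mxE.
pose f x := if (x < b)%N then window_cross v (x2 + x)%N else U (x - b)%N.
have detUi m (g : nat -> nat -> F) :
  (forall x y, (x < m)%N -> (y < m)%N -> g x y = D *+ (x == y)) ->
  \det (\matrix_(x < m, y < m) g x y) = D ^+ m.
  move=> gE; rewrite -det_scalar; congr (\det _).
  by apply/matrixP => x y; rewrite !mxE gE.
have E1 : \det (colmx f) * D =
    s * ((\prod_(x < b) window_det v (x2 + x)%N) * D ^+ a).
  rewrite -[in LHS]det_tr -det_mulmx trmx_mul_colmx.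
  pose g x y := dot (f x) (v (x2 + q + y)%N).
  rewrite -[\matrix_(_, _) _]/(\matrix_(x < k, y < k) g x y).
  rewrite (@det_zero_block _ b a) => [||x y xb ya]; first last.
  - rewrite /g /f xb.
    have -> : (x2 + q + y = (x2 + x) + (q + y - x))%N by lia.
    by apply: dot_window_cross0; lia.
  - by lia.
  rewrite [(b * a)%N]mulnC; congr (_ * (_ * _)).
    rewrite -det_dot_window_cross; try lia.
    congr (\det _); apply/matrixP => x y; rewrite !mxE /g /f ltn_ord.
    by congr (dot _ (v _)); lia.
  apply: (detUi a (fun x y => g (b + x) y)%N) => x y xa ya; rewrite /g /f.
  by rewrite ltnNge leq_addr addKn UP //; lia.
have E2 : \det (colmx f) * \det VJ = \det Y * D ^+ a.
  rewrite -det_tr -det_mulmx trmx_mul_colmx.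
  pose g x y := dot (f x) (v (two_runs b (x1 + p) (x2 + q) y)).
  rewrite -[\matrix_(_, _) _]/(\matrix_(x < k, y < k) g x y).
  rewrite (@det_lzero_block _ b a) => [||x y xb ya]; first last.
  - rewrite /g /f xb /two_runs ltnNge leq_addr addKn /=.
    have -> : (x2 + q + y = (x2 + x) + (q + y - x))%N by lia.
    by apply: dot_window_cross0; lia.
  - by lia.
  congr (_ * _).
    congr (\det _); apply/matrixP => x y; rewrite !mxE /g /f /two_runs !ltn_ord.
    by [].
  apply: (detUi a (fun x y => g (b + x) (b + y))%N) => x y xa ya.
  rewrite /g /f /two_runs.
  by rewrite ![(b + _ < b)%N]ltnNge !leq_addr !addKn UP //; lia.
have Da : D ^+ a != 0 by rewrite expf_neq0.
apply: (mulIf Da).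
rewrite [RHS]mulrAC -E2 [RHS]mulrAC E1; ring.
Qed.

Lemma window_cross_det_generic :
  \det T = \det VJ * (\prod_(x < p) window_det v (x1 + x)%N)
                   * (\prod_(x < q) window_det v (x2 + x)%N).
Proof.
have := det_cross_windows; have := det_dual_windows.
rewrite !big_ord_recr /=.
set D := window_det v (x1 + p)%N; set D' := window_det v (x2 + q)%N.
set P := \prod_(_ < _) _; set P' := \prod_(_ < _) _ => E2 E1.
have ss : s * s = 1 by rewrite -expr2 sqrr_sign.
apply: (mulIf Di_neq0); apply: (mulIf Dj_neq0); rewrite -/D -/D' E1.
rewrite -[LHS]mulrA -[_ * _ * D']mulrA -E2.
transitivity ((s * s) * (P' * D * P * D' * \det VJ)); first ring.
by rewrite ss; ring.
Qed.

End Generic.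

Section Functoriality.
Variables (F G : comNzRingType) (phi : {rmorphism F -> G}) (k : nat).

Lemma map_colmx (f : nat -> 'cV[F]_k) :
  map_mx phi (colmx f) = colmx (fun y => map_mx phi (f y)).
Proof. by apply/matrixP => x y; rewrite !mxE. Qed.

Lemma map_window_det (v : nat -> 'cV[F]_k) x :
  phi (window_det v x) = window_det (fun y => map_mx phi (v y)) x.
Proof. by rewrite /window_det -det_map_mx map_colmx. Qed.

Lemma map_window_cross (v : nat -> 'cV[F]_k) x :
  map_mx phi (window_cross v x) = window_cross (fun y => map_mx phi (v y)) x.
Proof.
apply/matrixP => z o; rewrite !mxE -det_map_mx; congr (\det _).
apply/matrixP => c d; rewrite !mxE; case: insubP => [d' _ _|_]; rewrite ?mxE //.
by rewrite rmorph_nat.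
Qed.
End Functoriality.

(** Factoring out B leaves the characteristic polynomial of - A B^-1, which is
    monic. *)
Lemma generic_window_neq0 (F : fieldType) k (A B : 'M[F]_k) : B \in unitmx ->
  \det (map_mx polyC A + 'X *: map_mx polyC B) != 0.
Proof.
move=> Bu.
have -> : map_mx polyC A + 'X *: map_mx polyC B =
    char_poly_mx (- (A *m invmx B)) *m map_mx polyC B.
  rewrite /char_poly_mx map_mxN opprK mulmxDl mul_scalar_mx -map_mxM.
  by rewrite mulmxKV // addrC.
rewrite det_mulmx mulf_neq0 //; first by rewrite monic_neq0 // char_poly_monic.
by rewrite det_map_mx polyC_eq0 -unitfE -unitmxE.
Qed.

(** The sequence v + X w over the polynomial ring specializes to v at X = 0.  For
    w the unit vectors are repeated antiperiodically, so that every window of w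
    has determinant 1 and no window determinant of v + X w vanishes. *)
Lemma window_cross_det (F : fieldType) k p q x1 x2 (v : nat -> 'cV[F]_k) :
  k = (p + q).+2 ->
  \det (colmx (fun y => window_cross v (two_runs p.+1 x1 x2 y))) =
  \det (colmx (fun y => v (two_runs q.+1 (x1 + p) (x2 + q) y)))
  * (\prod_(x < p) window_det v (x1 + x)%N)
  * (\prod_(x < q) window_det v (x2 + x)%N).
Proof.
move=> kE.
have k_gt0 : (0 < k)%N by rewrite kE.
pose w y : 'cV[F]_k :=
  (-1) ^+ (k.-1 * (y %/ k)) *: \col_x ((x : nat) == y %% k)%N%:R.
have wP y : w (y + k)%N = (-1) ^+ k.-1 *: w y.
  by rewrite /w divnDr // divnn k_gt0 modnDr mulnDr muln1 addnC exprD scalerA.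
have w_unit x : colmx (fun y => w (x + y)%N) \in unitmx.
  rewrite unitmxE; have := det_antiperiodic x wP; rewrite /window_det => ->.
  suff -> : colmx w = 1%:M by rewrite det1 unitr1.
  apply/matrixP => z y; rewrite !mxE divn_small // modn_small // muln0 mul1r.
  by rewrite -val_eqE.
pose v' x := map_mx polyC (v x) + 'X *: map_mx polyC (w x).
have v'_neq0 x : window_det v' x != 0.
  rewrite /window_det.
  have -> : colmx (fun y => v' (x + y)%N) =
      map_mx polyC (colmx (fun y => v (x + y)%N))
      + 'X *: map_mx polyC (colmx (fun y => w (x + y)%N)).
    by apply/matrixP => y z; rewrite !mxE.
  exact: generic_window_neq0.
pose ev : {rmorphism {poly F} -> F} := horner_eval (0 : F).
have ev_v' x : map_mx ev (v' x) = v x.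
  by apply/matrixP => y z; rewrite !mxE /= /horner_eval !hornerE.
have evW x : ev (window_det v' x) = window_det v x.
  rewrite map_window_det; congr (\det _); apply: eq_colmx => y _; exact: ev_v'.
have evT x : map_mx ev (window_cross v' x) = window_cross v x.
  rewrite map_window_cross; congr (cross _); apply/matrixP => y z.
  by rewrite [LHS]mxE [RHS]mxE ev_v'.
have := congr1 ev
  (window_cross_det_generic kE (v'_neq0 (x1 + p)%N) (v'_neq0 (x2 + q)%N)).
rewrite !rmorphM /= !rmorph_prod /=.
rewrite -!det_map_mx !map_colmx.
rewrite (eq_colmx (g := fun y => window_cross v (two_runs p.+1 x1 x2 y))) => [->|y _];
  last exact: evT.
congr (\det _ * _ * _); first by apply: eq_colmx.
all: by apply: eq_bigr => x _; apply: evW.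
Qed.
(** * Unrolling the cyclic index set *)

Section Indices.
Variable n : nat.
Implicit Types (i : 'I_n.+1) (s : nat -> nat).

Lemma iter_sigma_inZp r x : iter r sigma (inZp (x + r) : 'I_n.+1) = inZp x.
Proof.
elim: r x => [|r IHr] x; first by rewrite addn0.
rewrite iterSr -[RHS]IHr; congr (iter r sigma _); apply/val_inj => /=.
by rewrite !addnS /= modnDml addSnnS modnDr.
Qed.

Lemma inZp_addn x : inZp (x + n.+1) = inZp x :> 'I_n.+1.
Proof. by apply/val_inj; rewrite /= modnDr. Qed.

Lemma sigma_seg_inZp a m x :
  sigma_seg a (a + m) (inZp (x + (a + m)) : 'I_n.+1) =
  [set inZp (x + y) | y : 'I_m.+1].
Proof.
apply/setP => z; apply/imsetP/imsetP => [[r ar ->]|[y _ ->]].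
  have rm := ltn_ord r; rewrite inE in ar.
  have ym : (a + m - r < m.+1)%N by lia.
  exists (Ordinal ym) => //=.
  by rewrite -[RHS](iter_sigma_inZp r); congr (iter _ _ (inZp _)); lia.
have ym := ltn_ord y.
have rm : (a + m - y < (a + m).+1)%N by lia.
exists (Ordinal rm); first by rewrite inE /=; lia.
by rewrite /= -[LHS](iter_sigma_inZp (a + m - y)); congr (iter _ _ (inZp _)); lia.
Qed.

Lemma iter_sigma_set_inZp m r x :
  iter r sigma_set [set (inZp (x + r + y) : 'I_n.+1) | y : 'I_m] =
  [set inZp (x + y) | y : 'I_m].
Proof.
elim: r x => [|r IHr] x; first by apply: eq_imset => y; rewrite addn0.
rewrite iterSr -[RHS]IHr; congr (iter r _ _).
rewrite /sigma_set -imset_comp; apply: eq_imset => y /=.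
by rewrite -[RHS](iter_sigma_inZp 1); congr (sigma (inZp _)); lia.
Qed.

Lemma imset_two_runs a b x1 x2 :
  [set (inZp (two_runs a x1 x2 y) : 'I_n.+1) | y : 'I_(a + b)] =
  [set inZp (x1 + y) | y : 'I_a] :|: [set inZp (x2 + y) | y : 'I_b].
Proof.
apply/setP => z; rewrite inE; apply/imsetP/orP.
  case=> y _ ->; rewrite /two_runs; case: ltnP => ya; [left|right].
    by apply/imsetP; exists (Ordinal ya).
  have yb : (y - a < b)%N by have := ltn_ord y; lia.
  by apply/imsetP; exists (Ordinal yb).
case=> /imsetP[y _ ->].
  by exists (lshift b y); rewrite // /two_runs /= ltn_ord.
by exists (rshift a y); rewrite // /two_runs /= ltnNge leq_addr addKn.
Qed.

(** Both inequalities together say that s 0, ..., s (k-1) increases and fits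
    within one period n + 1, so that its residues are distinct and in cyclic
    order. *)
Definition spread k s :=
  forall x y, (x < y < k)%N -> (s x < s y < s x + n.+1)%N.

Lemma spread_inj k s :
  spread k s -> injective (fun y : 'I_k => inZp (s y) : 'I_n.+1).
Proof.
move=> sP.
have lt_neq (x y : 'I_k) : (x < y)%N -> inZp (s x) <> inZp (s y) :> 'I_n.+1.
  move=> xy /(congr1 val) /= /eqP.
  have /andP[lt1 lt2] := sP x y (introT andP (conj xy (ltn_ord y))).
  rewrite eq_sym eqn_mod_dvd ?(ltnW lt1) // gtnNdvd ?subn_gt0 //; lia.
move=> x y eq_xy; apply/val_inj.
by case: (ltngtP x y) => // /lt_neq; rewrite eq_xy.
Qed.

Lemma spread_two_runs k a x1 x2 :
  (x1 + a <= x2)%N -> (x2 + k <= x1 + a + n.+1)%N -> spread k (two_runs a x1 x2).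
Proof.
move=> h1 h2 x y /andP[xy yk]; rewrite /two_runs.
case: (ltnP x a) => xa; case: (ltnP y a) => ya; lia.
Qed.

End Indices.

(** * Pluecker coordinates and the twist in terms of unrolled columns *)

Section Unroll.
Variables (F : comNzRingType) (k n : nat).
Implicit Types (M : 'M[F]_(k, n.+1)) (s : nat -> nat).

(** The sign (-1)^(k-1) per turn is the one of a cyclic rotation of k columns. *)
Definition unroll M (x : nat) : 'cV[F]_k :=
  (-1) ^+ (k.-1 * (x %/ n.+1)) *: col (inZp x) M.

Lemma unroll_addn M x c :
  unroll M (x + c * n.+1) = (-1) ^+ (k.-1 * c) *: unroll M x.
Proof.
rewrite /unroll divnDMl // mulnDr addnC exprD scalerA; congr (_ *: col _ _).
by apply/val_inj; rewrite /= addnC modnMDl.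
Qed.

(** Extend s to an increasing sequence e with e (x + k) = e x + n + 1.  By
    antiperiodicity, s can be replaced by the k terms of e that follow the first
    multiple c (n + 1) above s 0.  These terms lie between two consecutive
    multiples of n + 1, so their residues increase, and the signs cancel because
    k (k - 1) is even. *)
Lemma plucker_unroll M s : (0 < k)%N -> spread n k s ->
  plucker [set inZp (s y) | y : 'I_k] M = \det (colmx (fun y => unroll M (s y))).
Proof.
move=> k_gt0 sP.
pose e x := (s (x %% k) + (x %/ k) * n.+1)%N.
have eD x : e (x + k)%N = (e x + n.+1)%N.
  by rewrite /e modnDr divnDr // divnn k_gt0 addn1 mulSn; lia.
have eE x : (x < k)%N -> e x = s x.
  by move=> xk; rewrite /e modn_small // divn_small // addn0.
have eS x : (e x < e x.+1)%N.
  rewrite {1}(divn_eq x k) [in X in (_ < e X)%N](divn_eq x k) -addnS.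
  have xk := ltn_pmod x k_gt0.
  elim: (x %/ k)%N => [|c IHc]; last first.
    by rewrite mulSn -!addnA ![(k + _)%N]addnC !eD; lia.
  rewrite !mul0n !add0n (eE (x %% k)%N) //.
  case: (ltnP (x %% k).+1 k) => xk'.
    by rewrite eE //; have := sP (x %% k)%N (x %% k).+1; lia.
  have -> : ((x %% k).+1 = 0 + k)%N by lia.
  rewrite eD eE //; case: (posnP (x %% k)) => [->|x0]; first by lia.
  by have := sP 0%N (x %% k)%N; lia.
have e_lt : {homo e : x y / (x < y)%N} := homo_ltn ltn_trans eS.
pose c := (s 0 %/ n.+1).+1.
have exm : exists m, (c * n.+1 <= e m)%N.
  exists k; have := eD 0%N; rewrite add0n (eE 0%N) // /c => ->.
  by have := divn_eq (s 0%N) n.+1; have := ltn_pmod (s 0%N) (ltn0Sn n); lia.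
have := find_ex_minn exm => -[m cm m_min].
have m_gt0 : (0 < m)%N.
  rewrite lt0n; apply: contraTneq cm => ->.
  rewrite -ltnNge eE // {1}(divn_eq (s 0) n.+1) /c.
  by have := ltn_pmod (s 0%N) (ltn0Sn n); lia.
have em1 : (e m.-1 < c * n.+1)%N.
  by rewrite ltnNge; apply/negP => /m_min; lia.
have in_block y : (y < k)%N -> (c * n.+1 <= e (m + y) < c * n.+1 + n.+1)%N.
  move=> yk; apply/andP; split.
    case: y yk => [|y] yk; first by rewrite addn0.
    by have := e_lt m (m + y.+1)%N; lia.
  have := eD m.-1; have : (e (m + y) <= e (m.-1 + k))%N.
    by case: (ltngtP (m + y)%N (m.-1 + k)%N) => [/e_lt/ltnW||->] //; lia.
  lia.
have fP : spread n k (fun y => e (m + y)%N).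
  move=> x y /andP[xy yk]; have := e_lt (m + x)%N (m + y)%N.
  have := in_block x (ltn_trans xy yk); have := in_block y yk; lia.
pose f y : 'I_n.+1 := inZp (e (m + y)).
have fE y : (y < k)%N -> f y = (e (m + y) - c * n.+1)%N :> nat.
  move=> /in_block yP.
  rewrite /= -[e (m + y)%N in LHS](@subnK (c * n.+1)); last by lia.
  by rewrite addnC modnMDl modn_small //; lia.
have -> : [set inZp (s y) | y : 'I_k] = (fun y : 'I_k => f y) @: [set: 'I_k].
  apply/esym/eqP; rewrite eqEcard; apply/andP; split; last first.
    rewrite (card_imset _ (spread_inj sP)) (card_imset _ (spread_inj fP)).
    by rewrite cardsT.
  apply/subsetP => _ /imsetP[y _ ->]; apply/imsetP.
  exists (Ordinal (ltn_pmod (m + y) k_gt0)) => //=.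
  by apply/val_inj; rewrite /= /e addnC modnMDl.
rewrite pluckerE; last first.
  move=> x y xy; rewrite !fE //.
  have /andP[hx _] := in_block x (ltn_ord x).
  have /andP[hy _] := in_block y (ltn_ord y).
  have := e_lt (m + x)%N (m + y)%N; lia.
have -> : \det (colmx (fun y => unroll M (s y))) =
    \det (colmx (fun y => unroll M (e y))).
  by congr (\det _); apply: eq_colmx => y yk; rewrite eE.
rewrite -(@det_antiperiodic _ _ (fun y => unroll M (e y)) m); last first.
  by move=> y; rewrite eD -{1}[n.+1]mul1n unroll_addn muln1.
rewrite /window_det.
have -> : colmx (fun y => unroll M (e (m + y)%N)) =
    colmx (fun y => (-1) ^+ (k.-1 * c) *: col (f y) M).
  apply: eq_colmx => y yk; rewrite /unroll; congr (_ ^+ (_ * _) *: _).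
  have := in_block y yk => yP.
  rewrite -[e (m + y)%N](@subnK (c * n.+1)); last by lia.
  by rewrite addnC divnMDl // divn_small ?addn0 //; lia.
rewrite det_colmxZ prodr_const card_ord -exprM -signr_odd !oddM.
have -> : odd k.-1 && odd c && odd k = false.
  by case: k k_gt0 => // k' _ /=; case: (odd k'); rewrite ?andbF.
rewrite mul1r; congr (\det _); by apply/matrixP => x y; rewrite !mxE.
Qed.

(** Multilinearity reduces this to comparing signs.  With k' = k - 1 and
    x + k' = c (n + 1) + i, the last i of the k' factors (all of them if
    i >= k') come from the turn c and the others from the turn c - 1, so the
    signs of the factors have product (-1)^(k' (k' c - (k' - i))) when i <= k'.
    The first term of the exponent is the sign of column x + k' of the unrolled
    twist.  The second is the sign in the definition of the twist, as
    (i + 1)(k' - i) and k' (k' - i) differ by the product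
    (k' - i - 1)(k' - i) of two consecutive integers. *)
Lemma unroll_twist M x : (k <= n.+1)%N -> (0 < k)%N ->
  unroll (twist M) (x + k.-1) = window_cross (unroll M) x.
Proof.
move=> kn k_gt0.
set z := (x + k.-1)%N.
have zE := divn_eq z n.+1; have iP := ltn_pmod z (ltn0Sn n).
set c := (z %/ n.+1)%N in zE *; set i := (z %% n.+1)%N in zE iP *.
pose V : 'M[F]_(k, k.-1) :=
  colsub (fun y : 'I_k.-1 => iter (k.-1 - y) sigma (inZp z : 'I_n.+1)) M.
pose g y : F := if (y < k.-1)%N then (-1) ^+ (k.-1 * ((x + y) %/ n.+1)) else 1.
(* g y is the sign of the y-th factor; its value 1 at y = k - 1 is the one of
   the unit vector that completes the columns of the cross product. *)
have liftE y : (y < k.-1)%N ->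
   unroll M (x + y)%N = g y *: col (iter (k.-1 - y) sigma (inZp z)) M.
  move=> yk; rewrite /unroll /g yk; congr (_ *: col _ _).
  rewrite -[LHS](iter_sigma_inZp n (k.-1 - y)); congr (iter _ _ (inZp _)).
  by rewrite /z; lia.
apply/matrixP => r o; rewrite ord1 !mxE.
pose W y : 'cV[F]_k := if insub y is Some d then col d V else delta_mx r 0.
transitivity (\prod_(y < k) g y * \det (colmx W)); last first.
  rewrite -det_colmxZ; congr (\det _); apply/matrixP => a b; rewrite !mxE /W.
  case: insubP => [d dk <-|].
    by rewrite [RHS]mxE liftE // !mxE.
  by rewrite /g => /negPf ->; rewrite !mxE mul1r.
have -> : \det (add_last_col V (delta_mx r 0)) = \det (colmx W).
  congr (\det _); apply/matrixP => a b; rewrite !mxE /W.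
  by case: insubP => [d dk _|]; rewrite !mxE.
rewrite mulrA; congr (_ * _).
rewrite -/c /=.
set k' := k.-1 in zE g liftE *.
have gE : \prod_(y < k) g y = (-1) ^+ (k' * \sum_(y < k') ((x + y) %/ n.+1)).
  rewrite big_distrr -prodrXr /=.
  have -> : k = k'.+1 by rewrite /k'; lia.
  rewrite big_ord_recr /= {2}/g ltnn mulr1.
  by apply: eq_bigr => y _; rewrite /g ltn_ord.
have wraps y : (y < k')%N -> ((x + y) %/ n.+1 + (y < k' - i) = c)%N.
  move=> yk; case: ltnP => yi.
    have c_gt0 : (0 < c)%N.
      by rewrite lt0n; apply/eqP => c0; rewrite c0 /z in zE; lia.
    have -> : (x + y = c.-1 * n.+1 + (n.+1 + i + y - k'))%N.
      by move: zE; rewrite /z -{1}(prednK c_gt0) mulSn; lia.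
    by rewrite divnMDl // divn_small; lia.
  have -> : (x + y = c * n.+1 + (i + y - k'))%N by move: zE; rewrite /z; lia.
  by rewrite divnMDl // divn_small; lia.
have sumE : (\sum_(y < k') ((x + y) %/ n.+1) + (k' - i) = k' * c)%N.
  have -> : (k' - i = \sum_(y < k') (y < k' - i))%N.
    rewrite -big_mkcond -(big_ord_widen _ (fun=> 1%N)) ?leq_subr //.
    by rewrite sum1_card card_ord.
  rewrite -big_split /= (eq_bigr (fun=> c)) => [|y _]; last exact: wraps.
  by rewrite sum_nat_const card_ord.
rewrite gE; move: sumE; set S := (\sum_(_ < _) _)%N => sumE.
have -> : twist_sign F k i.+1 = (-1) ^+ (k' * (k' - i)).
  rewrite /twist_sign -/k'; case: (ltnP i k') => ik.
    have -> : (k - i.+1 = k' - i)%N by rewrite /k'; lia.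
    rewrite -[LHS]signr_odd -[RHS]signr_odd; congr (_ ^+ nat_of_bool _).
    rewrite !oddM oddB ?(ltnW ik) //=.
    by case: (odd i); case: (odd k').
  by rewrite (eqP (_ : k' - i == 0)%N) ?muln0 // subn_eq0.
rewrite -exprD -mulnDr -[LHS]signr_odd -[RHS]signr_odd.
congr (_ ^+ nat_of_bool _); have := congr1 odd sumE.
rewrite !oddM !oddD.
by case: (odd k'); case: (odd c); case: (odd S); case: (odd _).
Qed.


End Unroll.
(** The number d is the cyclic distance from i to j.  If d <= q the second arc
    would contain i, and if n + 1 - d <= p the first one would contain j.  The
    offset m leaves room for the m indices below i. *)
Lemma unroll_disjoint_segs n p q (i j : 'I_n.+1) m :
  [disjoint sigma_seg 0 p i & sigma_seg 0 q j] -> (m <= n.+1)%N ->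
  exists x d, [/\ i = inZp (x + m), j = inZp (x + d + m),
                  (q < d)%N & (d + p < n.+1)%N].
Proof.
move=> dis mn.
pose x := (i + n.+1 - m)%N; pose d := ((j + n.+1 - i) %% n.+1)%N.
have iE : i = inZp (x + m).
  by apply/val_inj; rewrite /= /x subnK ?modnDr ?modn_small //; lia.
have dn : (d < n.+1)%N by rewrite ltn_mod.
have jE : j = inZp (x + d + m).
  apply/val_inj; rewrite /= /d.
  have -> : (x + (j + n.+1 - i) %% n.+1 + m =
      (j + n.+1 - i) %% n.+1 + (i + n.+1))%N.
    by have := ltn_ord i; rewrite /x; lia.
  rewrite modnDml.
  have -> : (j + n.+1 - i + (i + n.+1) = j + n.+1 + n.+1)%N.
    by have := ltn_ord i; lia.
  by rewrite !modnDr modn_small.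
have notin y r : (r <= p)%N -> (y <= q)%N -> iter r sigma i <> iter y sigma j.
  move=> rp yq eq_ij; have /pred0P/(_ (iter r sigma i)) := dis.
  rewrite /= => /negP; apply.
  apply/andP; split; first by apply/imsetP; exists (inord r); rewrite ?inordK.
  by rewrite eq_ij; apply/imsetP; exists (inord y); rewrite ?inordK.
exists x, d; split => //.
  rewrite ltnNge; apply/negP => dq; apply: (notin d 0%N) => //=.
  by rewrite iE jE -(iter_sigma_inZp n d); congr (iter _ _ (inZp _)); lia.
rewrite ltnNge; apply/negP => dp; apply: (notin 0%N (n.+1 - d)%N) => //=; first lia.
rewrite iE jE -(inZp_addn n (x + m)) -[RHS](iter_sigma_inZp n (n.+1 - d)).
by congr (iter _ _ (inZp _)); lia.
Qed.

Lemma prod_plucker_cyc_int (F : comNzRingType) k n p (M : 'M[F]_(k, n.+1)) x :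
  (0 < k)%N -> (k <= n.+1)%N ->
  \prod_(1 <= r < p.+1)
     plucker (iter r sigma_set (cyc_int k (inZp (x + p + k.-1) : 'I_n.+1))) M =
  \prod_(y < p) window_det (unroll M) (x + y).
Proof.
move=> k_gt0 kn; rewrite big_add1 /= big_mkord (reindex_inj rev_ord_inj) /=.
apply: eq_bigr => y _.
have yp := ltn_ord y.
rewrite -iterS; have -> : (p - y.+1).+1 = (p - y)%N by lia.
have -> : cyc_int k (inZp (x + p + k.-1) : 'I_n.+1) =
    [set inZp (x + y + (p - y) + z) | z : 'I_k.-1.+1].
  rewrite /cyc_int (@sigma_seg_inZp n 0); apply: eq_imset => z.
  by congr (inZp _); lia.
rewrite iter_sigma_set_inZp (prednK k_gt0) plucker_unroll //.
by move=> a b ab; lia.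
Qed.

Theorem proposition3p5 (R : realType) (k n : nat)
    (k_gt0 : (0 < k)%N) (k_le_n : (k <= n)%N)
    (p q : nat) (pq_k : (p + q + 2 = k)%N) (i j : 'I_n)
    (I I1 I2 J : {set 'I_n})
    (card_I : #|I| = k)
    (I_def : I = I1 :|: I2) (I_disj : [disjoint I1 & I2])
    (I1_def : I1 = sigma_seg 0 p i)
    (I2_def : I2 = sigma_seg 0 q j)
    (J_def : J = sigma_seg p.+1 (p + q + 1) i
                 :|: sigma_seg q.+1 (p + q + 1) j) :
  #|J| = k /\
  forall M : 'M[complex R]_(k, n),
    twist_fun (plucker I) M =
      plucker J M
      * \prod_(1 <= r < p.+1) plucker (iter r sigma_set (cyc_int k i)) M
      * \prod_(1 <= r < q.+1) plucker (iter r sigma_set (cyc_int k j)) M.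
Proof.
case: n k_le_n i j I I1 I2 J card_I I_def I_disj I1_def I2_def J_def
  => [|n] k_le_n i j I I1 I2 J _ -> dis I1_def I2_def ->.
  by have := ltn_ord i.
move: dis; rewrite {}I1_def {}I2_def => dis.
(* The p + (k - 1) indices below i that occur in the formula must have
   nonnegative representatives; one more turn makes room for p of them. *)
have [a [d [iE jE qd dp]]] : exists a d,
    [/\ i = inZp (a + p + k.-1), j = inZp (a + p + d + k.-1),
        (q < d)%N & (d + p < n.+1)%N].
  have kn : (k.-1 <= n.+1)%N by lia.
  have [x [d [-> -> qd dp]]] := unroll_disjoint_segs dis kn.
  exists (x + n.+1 - p)%N, d; split => //.
    by rewrite -inZp_addn; congr inZp; lia.
  by rewrite -inZp_addn; congr inZp; lia.
pose b := (a + p + d - q)%N.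
have {}jE : j = inZp (b + q + k.-1) by rewrite jE; congr inZp; rewrite /b; lia.
have IE : sigma_seg 0 p i :|: sigma_seg 0 q j =
    [set inZp (two_runs p.+1 (a + k.-1) (b + k.-1) y) | y : 'I_k].
  have kE : k = (p.+1 + q.+1)%N by lia.
  have := imset_two_runs n p.+1 q.+1 (a + k.-1) (b + k.-1); rewrite -kE => ->.
  rewrite iE jE; congr (_ :|: _).
    have -> : (a + p + k.-1 = a + k.-1 + (0 + p))%N by lia.
    exact: sigma_seg_inZp.
  have -> : (b + q + k.-1 = b + k.-1 + (0 + q))%N by lia.
  exact: sigma_seg_inZp.
have JE : sigma_seg p.+1 (p + q + 1) i :|: sigma_seg q.+1 (p + q + 1) j =
    [set inZp (two_runs q.+1 (a + p) (b + q) y) | y : 'I_k].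
  have kE : k = (q.+1 + p.+1)%N by lia.
  have := imset_two_runs n q.+1 p.+1 (a + p) (b + q); rewrite -kE => ->.
  rewrite iE jE; congr (_ :|: _).
    have -> : (p + q + 1 = p.+1 + q)%N by lia.
    have -> : k.-1 = (p.+1 + q)%N by lia.
    exact: sigma_seg_inZp.
  have -> : (p + q + 1 = q.+1 + p)%N by lia.
  have -> : k.-1 = (q.+1 + p)%N by lia.
  exact: sigma_seg_inZp.
have Ispread : spread n k (two_runs p.+1 (a + k.-1) (b + k.-1)).
  by apply: spread_two_runs; rewrite /b; lia.
have Jspread : spread n k (two_runs q.+1 (a + p) (b + q)).
  by apply: spread_two_runs; rewrite /b; lia.
split=> [|M].
  by rewrite JE (card_imset _ (spread_inj Jspread)) card_ord.
rewrite /twist_fun IE JE !plucker_unroll //.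
have -> : colmx (fun y =>
      unroll (twist M) (two_runs p.+1 (a + k.-1) (b + k.-1) y)) =
    colmx (fun y => window_cross (unroll M) (two_runs p.+1 a b y)).
  apply: eq_colmx => y _; rewrite -unroll_twist //; congr unroll.
  by rewrite /two_runs; case: ifP; lia.
rewrite (@window_cross_det _ _ p q); last by lia.
by rewrite iE jE !prod_plucker_cyc_int.
Qed.
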